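(* Assume that there exist two positive constants $V_1$ and $V_2$ such that $$\mathbb E\big[(G_{X_1}(X_1))^2\big]\le V_1\quad\text{and}\quad\mathbb E\big[(G_\varepsilon(\varepsilon))^2\big]\le V_2.$$ Let $V=V_1(K_{n-1}(\rho))^2+V_2\sum_{i=2}^n(K_{n-i}(\rho))^2$. Then, for any $x,y>0$, $$\mathbb P(\pm S_n>x)\le H_n\left(\frac{x}{yK_{n-1}(\rho)},\frac{\sqrt V}{yK_{n-1}(\rho)}\right)+\mathbb P\left(\max\Big\{G_{X_1}(X_1),\max_{2\le i\le n}G_\varepsilon(\varepsilon_i)\Big\}>y\right),$$ where $$H_n(x,v)=\left\{\Big(\frac{v^2}{x+v^2}\Big)^{x+v^2}\Big(\frac{n}{n-x}\Big)^{n-x}\right\}^{\frac{n}{n+v^2}}\mathbf 1_{\{x\le n\}}$$ with the convention that $(+\infty)^0=1$ (which applies when $x=n$).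
   Context: $(\mathcal X,d)$ and $(\mathcal Y,\delta)$ are complete separable metric spaces; $(\varepsilon_i)_{i\ge1}$ is a sequence of iid $\mathcal Y$-valued random variables; $X_1$ is an $\mathcal X$-valued random variable independent of $(\varepsilon_i)_{i\ge2}$. The Markov chain is $X_n=F(X_{n-1},\varepsilon_n)$ for $n\ge2$, where $F:\mathcal X\times\mathcal Y\to\mathcal X$ is measurable and satisfies, for some $\rho\in[0,1)$ and $C>0$, $\mathbb E[d(F(x,\varepsilon_1),F(x',\varepsilon_1))]\le\rho\,d(x,x')$ for all $x,x'\in\mathcal X$, and $d(F(x,y),F(x,y'))\le C\,\delta(y,y')$ for all $x\in\mathcal X$, $y,y'\in\mathcal Y$. Fix $n\ge1$ and $f:\mathcal X^n\to\mathbb R$ with $|f(x_1,\ldots,x_n)-f(x_1',\ldots,x_n')|\le d(x_1,x_1')+\cdots+d(x_n,x_n')$, and let $S_n=f(X_1,\ldots,X_n)-\mathbb E[f(X_1,\ldots,X_n)]$. Let $P_{X_1}$ be the law of $X_1$, $P_\varepsilon$ the common law of the $\varepsilon_k$'s, $G_{X_1}(x)=\int d(x,x')P_{X_1}(dx')$, $G_\varepsilon(y)=\int C\,\delta(y,y')P_\varepsilon(dy')$; $G_\varepsilon(\varepsilon)$ denotes a random variable distributed as $G_\varepsilon(\varepsilon_k)$. For $k\in\mathbb N$, $K_k(\rho)=1+\rho+\cdots+\rho^k$. Statements with $\pm$ hold for each of the two signs. *)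

(* Defs.v *)
From HB Require Import structures.
From mathcomp Require Import all_boot all_order all_algebra finmap.
From mathcomp Require Import all_classical all_reals all_analysis.

Set Implicit Arguments.
Unset Strict Implicit.
Unset Printing Implicit Defensive.

Import Order.TTheory GRing.Theory Num.Theory.
Import numFieldNormedType.Exports.

Local Open Scope classical_set_scope.
Local Open Scope ring_scope.

#[short(type="completeMetricType")]
HB.structure Definition CompleteMetric (K : numDomainType) :=
  {T of Metric K T & Complete T}.

Definition separable_space (T : topologicalType) : Prop :=
  exists2 D : set T, countable D & dense D.

Notation borel T := (g_sigma_algebraType (@open T)).

Section independence.
Context d d' (Omega : measurableType d) (E : measurableType d') (R : realType).
Variable P : probability Omega R.

(* Product rule over every finite subfamily of (X i)_(i in D). *)
Definition mutually_independent (I : choiceType) (D : set I)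
    (X : I -> {RV P >-> E}) : Prop :=
  forall (J : {fset I}) (A : I -> set E),
    [set` J] `<=` D -> (forall i, i \in J -> measurable (A i)) ->
    P (\bigcap_(i in [set` J]) (X i @^-1` A i)) =
    (\prod_(i <- J) P (X i @^-1` A i))%E.

Definition identically_distributed (I : Type) (D : set I)
    (X : I -> {RV P >-> E}) : Prop :=
  forall i j, D i -> D j -> forall A, measurable A ->
    distribution P (X i) A = distribution P (X j) A.

Definition sigma_family (I : Type) (D : set I) (X : I -> {RV P >-> E}) :
    set (set Omega) :=
  <<s \bigcup_(i in D) preimage_set_system setT (X i) measurable >>.

End independence.

Definition independent_of_family d d1 d2 (Omega : measurableType d)
    (E1 : measurableType d1) (E2 : measurableType d2) (R : realType)
    (P : probability Omega R) (X : {RV P >-> E1}) (I : Type) (D : set I)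
    (Y : I -> {RV P >-> E2}) : Prop :=
  forall A B, preimage_set_system setT X measurable A -> sigma_family D Y B ->
    P (A `&` B) = (P A * P B)%E.

(* The integrals below are [0, +oo]-valued: no integrability is presupposed. *)
Definition mean_dist (R : realType) (T : completeMetricType R)
    (mu : probability (borel T) R) (x : T) : \bar R :=
  (\int[mu]_x' (mdist x (x' : T))%:E)%E.

Definition mean_scaled_dist (R : realType) (T : completeMetricType R) (C : R)
    (mu : probability (borel T) R) (y : T) : \bar R :=
  (\int[mu]_y' (C * mdist y (y' : T))%:E)%E.

Definition Kgeo (R : realType) (k : nat) (rho : R) : R :=
  \sum_(0 <= i < k.+1) rho ^+ i.

(* At x = n the second factor is (n / 0) `^ 0, which the library evaluates to
   1: this is the convention (+oo)^0 = 1. *)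
Definition Hn (R : realType) (n : nat) (x v : R) : R :=
  ((v ^+ 2 / (x + v ^+ 2)) `^ (x + v ^+ 2)
    * (n%:R / (n%:R - x)) `^ (n%:R - x)) `^ (n%:R / (n%:R + v ^+ 2))
  * (x <= n%:R)%R%:R.

Lemma Hn_at_n (R : realType) (n : nat) (v : R) :
  Hn n n%:R v =
  ((v ^+ 2 / (n%:R + v ^+ 2)) `^ (n%:R + v ^+ 2)) `^ (n%:R / (n%:R + v ^+ 2)).
Proof. by rewrite /Hn subrr powRr0 mulr1 lexx mulr1. Qed.

(* Main.v *)
Require Import Defs.
From HB Require Import structures.
From mathcomp Require Import all_boot all_order all_algebra finmap.
From mathcomp Require Import ring lra.
From mathcomp Require Import all_classical all_reals all_analysis.
From mathcomp Require Import measurable_realfun.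

Set Implicit Arguments.
Unset Strict Implicit.
Unset Printing Implicit Defensive.

Import Order.TTheory GRing.Theory Num.Theory.
Import numFieldNormedType.Exports.

Local Open Scope classical_set_scope.
Local Open Scope ring_scope.

(** The function f of the trajectory is split into martingale differences along
    the chain.  Averaging the last coordinate of f over its innovation gives a
    function g of one coordinate less, and g is again Lipschitz: its last
    coordinate has coefficient 1 + rho a if that of f has coefficient a, because
    one step of the chain contracts distances by rho on average
    ([average_lip]).  Starting from a = 1, the coefficients met on the way down
    are K_0, K_1, ..., K_(n-1).  The difference between f and g is a centered
    function of the fresh innovation eps_k, bounded by K_(n-k) G_eps(eps_k)
    ([lipschitz_centered]); the last average depends on X_1 alone and is handled
    in the same way with G_(X_1).

    Each difference D is then replaced by [clip M D]: it is divided by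
    M = y K_(n-1), and set to 0 where it exceeds M.  Where all the G's are at
    most y, nothing is removed, which is the source of the second term of the
    bound.  A clipped difference is at most 1, has nonpositive mean and second
    moment at most s_k, the bound on E[D^2] divided by M^2.  If a quadratic
    a + b xi + c xi^2 with b, c >= 0 dominates exp(t xi) on xi <= 1, its
    conditional exponential moment is therefore at most a + c s_k, a constant
    ([clip_mgf_le]), and E exp(t W) <= prod_k (a + c s_k) for the sum W of
    the clipped differences ([clipped_sum_exists]).

    It remains to choose t and the quadratic.  By the arithmetic-geometric mean
    inequality the product is at most (a + c s)^n, where s is the mean of the
    s_k.  The quadratic that equals exp(t xi) at 1 and is tangent to it at -s
    makes a + c s the Laplace transform at t of the centered law on {-s, 1}
    ([expR_le_two_point_quadratic]), and minimizing exp(-t x) (a + c s)^n over t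
    gives exactly H_n ([Hn_chernoff]).  Using one quadratic for all k replaces
    the usual appeal to the concavity in s of the logarithm of that transform.

    Conditioning on the past is expressed by Fubini's theorem: Omega with the
    sigma-algebra of X_1, eps_2, ..., eps_(k+1) is itself a measurable space, and
    the law of the pair (omega, eps_(k+2) omega) on its product with Y is a
    product measure ([history_indep], [integral_history_eps]). *)

(** * Exponential inequalities and the function H_n *)

Lemma le_of_derive_ge0 (R : realType) (f f' : R -> R) (a b : R) :
  (forall x : R, is_derive x 1 f (f' x)) -> a <= b ->
  (forall x, a < x < b -> 0 <= f' x) -> f a <= f b.
Proof.
move=> df; rewrite le_eqVlt => /predU1P[->//|ab] f'0.
have cf : {within `[a, b], continuous f}.
  apply: continuous_subspaceT => x; apply: differentiable_continuous.
  by apply/derivable1_diffP; case: (df x).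
have [c] := MVT ab (fun x _ => df x) cf.
rewrite in_itv/= => cab E; rewrite -subr_ge0 E mulr_ge0 ?f'0//.
by rewrite subr_ge0 ltW.
Qed.

Lemma expR_taylor2 (R : realType) (z : R) :
  (z <= 0 -> expR z <= 1 + z + z ^+ 2 / 2) /\
  (0 <= z -> 1 + z + z ^+ 2 / 2 <= expR z).
Proof.
pose h (u : R) := expR u - (u + 2^-1 * u ^+ 2).
have dh (u : R) : is_derive u 1 h (expR u - 1 - u).
  apply: is_derive_eq.
  by rewrite /GRing.scale/=; field.
have h0 : h 0 = 1 by rewrite /h expR0; ring.
have dh0 (u : R) : 0 <= expR u - 1 - u by have := expR_ge1Dx u; lra.
split=> z0.
- have := le_of_derive_ge0 dh z0 (fun x _ => dh0 x); rewrite h0 /h; lra.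
- have := le_of_derive_ge0 dh z0 (fun x _ => dh0 x); rewrite h0 /h; lra.
Qed.

Lemma expR_convex_from0 (R : realType) (theta Z : R) : 0 <= theta -> theta <= 1 ->
  expR (theta * Z) - 1 <= theta * (expR Z - 1).
Proof.
move=> t0 t1; set e := expR (theta * Z).
have e0 : 0 <= e by exact: expR_ge0.
have h1 : e * (1 + (Z - theta * Z)) <= expR Z.
  rewrite (_ : expR Z = e * expR (Z - theta * Z)) ?ler_wpM2l ?expR_ge1Dx//.
  by rewrite /e -expRD; congr expR; ring.
have h2 : e * (1 + (- (theta * Z))) <= 1.
  rewrite [leRHS](_ : 1 = e * expR (- (theta * Z))) ?ler_wpM2l ?expR_ge1Dx//.
  by rewrite /e -expRD subrr expR0.
have := ler_wpM2l t0 h1; have := ler_wpM2l (_ : 0 <= 1 - theta) h2.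
rewrite subr_ge0 => /(_ t1); nra.
Qed.

(** Both sides vanish at Z = 0, and the derivatives in Z are ordered because
    exp is convex ([expR_convex_from0]). *)
Lemma expR_remainder2_scale (R : realType) (theta Z : R) :
  0 <= theta -> theta <= 1 -> 0 <= Z ->
  expR (theta * Z) - 1 - theta * Z <= theta ^+ 2 * (expR Z - 1 - Z).
Proof.
move=> t0 t1 Z0.
pose h (u : R) := theta ^+ 2 * (expR u - u) - (expR (theta * u) - theta * u).
have dh (u : R) : is_derive u 1 h
    (theta * (theta * (expR u - 1) - (expR (theta * u) - 1))).
  have d1 : is_derive (u : R) 1 (fun v : R => theta * v) theta.
    by apply: is_derive_eq; rewrite /GRing.scale/= mulr1.
  apply: is_derive_eq.
  by rewrite /GRing.scale/=; ring.
have := le_of_derive_ge0 dh Z0; rewrite /h mulr0 expR0 => /(_ _)H.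
suff : theta ^+ 2 * (1 - 0) - (1 - 0) <=
    theta ^+ 2 * (expR Z - Z) - (expR (theta * Z) - theta * Z) by nra.
by apply: H => x _; rewrite mulr_ge0// subr_ge0 expR_convex_from0.
Qed.

(** This is the monotonicity of (exp z - 1 - z) / z^2.  On z > 0 it is a
    rescaling of [expR_remainder2_scale]; on z <= 0 the ratio is at most 1/2, its
    limit at 0, and it is at least 1/2 at Z. *)
Lemma expR_le_quadratic (R : realType) (z Z : R) : 0 < Z -> z <= Z ->
  expR z <= 1 + z + (expR Z - 1 - Z) / Z ^+ 2 * z ^+ 2.
Proof.
move=> Z0 zZ.
have [z0|z0] := leP z 0.
- have [h _] := expR_taylor2 z; have [_ k] := expR_taylor2 Z.
  apply: (le_trans (h z0)); rewrite lerD2l mulrC ler_wpM2r ?sqr_ge0//.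
  rewrite ler_pdivlMr ?exprn_gt0//; have := k (ltW Z0); lra.
- have := @expR_remainder2_scale _ (z / Z) Z _ _ (ltW Z0).
  rewrite divr_ge0 ?(ltW z0) ?(ltW Z0)// ler_pdivrMr// mul1r zZ.
  move=> /(_ isT isT); rewrite mulfVK ?gt_eqF// expr_div_n.
  rewrite [X in _ <= X -> _](_ : _ = (expR Z - 1 - Z) / Z ^+ 2 * z ^+ 2); first lra.
  by field; rewrite gt_eqF.
Qed.

(** The quadratic agrees with exp(t xi) at 1 and is tangent to it at -s.  These
    are the atoms of the centered law of variance s carried by {-s, 1}, so that
    a + c s, its integral against that law, is the Laplace transform of the law
    at t. *)
Lemma expR_le_two_point_quadratic (R : realType) (t s : R) : 0 < t -> 0 < s ->
  exists a b c : R, [/\ 0 <= b, 0 <= c,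
    forall xi, xi <= 1 -> expR (t * xi) <= a + b * xi + c * xi ^+ 2 &
    a + c * s = (expR (- (t * s)) + s * expR t) / (1 + s)].
Proof.
move=> t0 s0; pose Z := t * (1 + s).
have Z0 : 0 < Z by rewrite mulr_gt0// addr_gt0.
pose g := (expR Z - 1 - Z) / Z ^+ 2; pose e := expR (- (t * s)).
have e0 : 0 < e by exact: expR_gt0.
have g0 : 0 <= g.
  by rewrite divr_ge0 ?sqr_ge0//; have := expR_ge1Dx Z; lra.
exists (e * (1 + t * s + g * t ^+ 2 * s ^+ 2)),
  (e * (t + g * t ^+ 2 * s * 2)), (e * g * t ^+ 2).
have [t0' s0' e0'] : [/\ 0 <= t, 0 <= s & 0 <= e] by rewrite !ltW.
split.
- apply: mulr_ge0 => //; apply: addr_ge0 => //.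
  apply: mulr_ge0 => //; apply: mulr_ge0 => //.
  by apply: mulr_ge0 => //; exact: sqr_ge0.
- by apply: mulr_ge0; [exact: mulr_ge0|exact: sqr_ge0].
- move=> xi xi1.
  have -> : expR (t * xi) = e * expR (t * (xi + s)).
    by rewrite /e -expRD; congr expR; ring.
  have H : t * (xi + s) <= Z by rewrite /Z ler_pM2l// lerD2r.
  have := ler_wpM2l e0' (expR_le_quadratic Z0 H).
  rewrite -/g => /le_trans; apply.
  by rewrite le_eqVlt; apply/orP; left; apply/eqP; ring.
- have -> : expR t = e * expR Z.
    by rewrite /e -expRD; congr expR; rewrite /Z; ring.
  rewrite -/e /g /Z; field.
  by rewrite !gt_eqF// addr_gt0.
Qed.

Lemma prod_le_mean_exp (R : realFieldType) (I : finType) (u : I -> R) :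
  (0 < #|I|)%N -> (forall i, 0 <= u i) ->
  \prod_i u i <= ((\sum_i u i) / #|I|%:R) ^+ #|I|.
Proof.
move=> I0 u0.
by have [h _] := @leif_AGM _ _ predT u (fun i _ => u0 i); exact: h.
Qed.

(** H_n is the minimum over t of exp(-t x) times the n-th power of the transform
    of [expR_le_two_point_quadratic] for the mean variance v^2 / n. *)
Lemma Hn_chernoff (R : realType) (n : nat) (x v : R) :
  (0 < n)%N -> 0 < x -> x < n%:R -> 0 < v ->
  exists t a b c : R, [/\ 0 < t, 0 <= b, 0 <= c,
    forall xi, xi <= 1 -> expR (t * xi) <= a + b * xi + c * xi ^+ 2 &
    expR (- (t * x)) * (a + c * (v ^+ 2 / n%:R)) ^+ n = Hn n x v].
Proof.
move=> n_gt0 x0 xn v0; set N : R := n%:R in xn *.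
have N0 : 0 < N by rewrite ltr0n.
set w := v ^+ 2; have w0 : 0 < w by rewrite exprn_gt0.
have xw0 : 0 < x + w by rewrite addr_gt0.
have nx0 : 0 < N - x by rewrite subr_gt0.
have s0 : 0 < w / N by rewrite divr_gt0.
have nw0 : 0 < N + w by rewrite addr_gt0.
pose L1 := ln (w / (x + w)); pose L2 := ln (N / (N - x)).
have E1 : expR L1 = w / (x + w) by rewrite lnK// posrE divr_gt0.
have E2 : expR L2 = N / (N - x) by rewrite lnK// posrE divr_gt0.
(* the zero of the derivative in t: exp(t (1 + s)) = (s + x/n) / (s (1 - x/n))
   with s = v^2 / n *)
pose t := (L2 - L1) / (1 + w / N).
have t0 : 0 < t.
  apply: divr_gt0; last by rewrite addr_gt0.
  rewrite subr_gt0 -ltr_expR E1 E2 (@lt_le_trans _ _ 1)//.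
    by rewrite ltr_pdivrMr// mul1r ltrDr.
  by rewrite ler_pdivlMr// mul1r gerBl ltW.
have [a [b [c [b0 c0 abc E]]]] := expR_le_two_point_quadratic t0 s0.
exists t, a, b, c; split => //.
have {}E : a + c * (w / N) = expR (L2 - t * (w / N)).
  rewrite E.
  have -> : expR t = expR (- (t * (w / N))) * (expR L2 / expR L1).
    rewrite -expRB -expRD; congr expR; rewrite /t.
    by field; rewrite gt_eqF//= gt_eqF.
  rewrite expRD E1 E2 -/w -/N.
  by field; rewrite !gt_eqF.
rewrite -/N E -expRM_natl -expRD /Hn -/N -/w.
rewrite (ltW xn) mulr1 /powR.
have /negbTE-> : w / (x + w) != 0 by rewrite gt_eqF ?divr_gt0.
have /negbTE-> : N / (N - x) != 0 by rewrite gt_eqF ?divr_gt0.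
rewrite -expRD expR_eq0 expRK -/L1 -/L2; congr expR; rewrite -/N /t.
by field; rewrite !gt_eqF.
Qed.

(** * From exponential moments to tails *)

Lemma measurable_superlevel (R : realType) d (E : measurableType d)
    (h : E -> R) (x : R) :
  measurable_fun setT h ->
  measurable [set w | x < h w] /\ measurable [set w | x <= h w].
Proof.
move=> mh; split; rewrite -[X in measurable X]setTI.
- rewrite [X in _ `&` X](_ : _ = h @^-1` `]x, +oo[%classic).
    by apply: mh => //; exact: measurable_itv.
  by apply/seteqP; split => w; rewrite /= in_itv/= andbT.
- rewrite [X in _ `&` X](_ : _ = h @^-1` `[x, +oo[%classic).
    by apply: mh => //; exact: measurable_itv.
  by apply/seteqP; split => w; rewrite /= in_itv/= andbT.
Qed.

(** For x >= n the event is empty, as W <= n; otherwise this is the exponential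
    Markov inequality at the t of [Hn_chernoff], the factors being merged by the
    arithmetic-geometric mean inequality. *)
Lemma Hn_tail (R : realType) d (Omega : measurableType d)
    (P : probability Omega R) (W : Omega -> R) (n : nat) (s : nat -> R) (x v : R) :
  (0 < n)%N -> 0 < x -> 0 < v -> measurable_fun setT W ->
  (forall w, W w <= n%:R) -> (forall i, 0 <= s i) -> v ^+ 2 = \sum_(i < n) s i ->
  (forall t a b c, 0 <= b -> 0 <= c ->
     (forall xi, xi <= 1 -> expR (t * xi) <= a + b * xi + c * xi ^+ 2) ->
     (\int[P]_w (expR (t * W w))%:E <= (\prod_(i < n) (a + c * s i))%:E)%E) ->
  (P [set w | (x < W w)%R] <= (Hn n x v)%:E)%E.
Proof.
move=> n0 x0 v0 mW Wn s0 vs Wexp.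
have [mgt mge] := measurable_superlevel x mW.
have [xn|nx] := ltP x n%:R; last first.
  rewrite (_ : [set w | _] = set0) ?measure0 ?lee_fin ?mulr_ge0 ?powR_ge0//.
  apply/seteqP; split=> // w /= xW.
  by have := lt_le_trans xW (Wn w); rewrite ltNge nx.
have [t [a [b [c [t0 b0 c0 abc E]]]]] := Hn_chernoff n0 x0 xn v0.
pose WR : {RV P >-> R} := HB.pack W (isMeasurableFun.Build _ _ _ _ _ mW).
apply: (@le_trans _ _ (P [set w | (x <= WR w)%R])).
  by apply: le_measure; rewrite ?inE// => w /=; exact: ltW.
apply: (le_trans (chernoff WR x t0)).
rewrite -E [_ * _ ^+ n]mulrC EFinM lee_wpmul2r ?lee_fin ?expR_ge0//.
rewrite /mmt_gen_fun unlock.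
under eq_integral do rewrite /= mulrC.
apply: (le_trans (Wexp t a b c b0 c0 abc)); rewrite lee_fin.
(* the domination at xi = 0; it makes the factors nonnegative *)
have a1 : 1 <= a by have := abc 0 ler01; rewrite mulr0 expR0; lra.
have sum_eq : \sum_(i < n) (a + c * s i) = n%:R * (a + c * (v ^+ 2 / n%:R)).
  rewrite big_split/= sumr_const card_ord -big_distrr/= -vs -mulr_natl.
  by field; rewrite pnatr_eq0 -lt0n.
have := @prod_le_mean_exp R 'I_n (fun i => a + c * s i).
rewrite card_ord sum_eq mulrAC divff ?pnatr_eq0 -?lt0n// mul1r; apply => // i.
by rewrite addr_ge0 ?mulr_ge0// (le_trans ler01).
Qed.

(** * Lipschitz functions on separable metric spaces *)

Lemma dense_sequence (R : realType) (T : completeMetricType R) :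
  separable_space T ->
  exists q : nat -> T, forall (x : T) (e : R), 0 < e -> exists j, mdist x (q j) < e.
Proof.
move=> [D /countable_injP[g ginj] dD].
exists (fun j => xget point [set x | D x /\ g x = j]) => x e e0.
have [] := dD (ball x e)°.
- by exists x; exact: (nbhsx_ballx x e e0).
- exact: open_interior.
- move=> z [/interior_subset]; rewrite ballEmdist/= => xz Dz.
  exists (g z); case: xgetP => [y _ [Dy gy]|/(_ z)]; last by case.
  by rewrite (ginj y z) ?inE.
Qed.

Lemma measurable_lipschitz (R : realType) (T : completeMetricType R)
    (h : T -> R) (L : R) :
  (forall x x', `|h x - h x'| <= L * mdist x x') ->
  measurable_fun setT (h : borel T -> R).
Proof.
move=> hL; apply: (measurability _ (RGenOpens.measurableE R)).
move=> _ [_ [a [b ->]] <-]; rewrite setTI; apply: sub_sigma_algebra.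
have ch : continuous h.
  move=> x; apply/cvgrPdist_lt => e e0.
  have L0 : 0 < `|L| + 1 by rewrite ltr_pwDr.
  have d0 : 0 < e / (`|L| + 1) by rewrite divr_gt0.
  apply: filterS (nbhsx_ballx x _ d0) => y; rewrite ballEmdist/= => xy.
  apply: (le_lt_trans (hL _ _)); move: xy; rewrite ltr_pdivlMr// => xy.
  apply: le_lt_trans xy; rewrite mulrC ler_wpM2l ?mdist_ge0//.
  by rewrite (le_trans (ler_norm _))// lerDl.
by move/continuousP : ch; apply; exact: interval_open.
Qed.

Lemma mdist_lip (R : realType) (T : completeMetricType R) (z x x' : T) :
  `|mdist z x - mdist z x'| <= mdist x x'.
Proof.
have := metric_triangle z x' x; have := metric_triangle z x x'.
by rewrite (metric_sym x' x) ler_norml; lra.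
Qed.

Lemma measurable_mdist (R : realType) (T : completeMetricType R) (z : T) :
  measurable_fun setT ((mdist z : T -> R) : borel T -> R).
Proof. by apply: (@measurable_lipschitz _ _ _ 1) => x x'; rewrite mul1r mdist_lip. Qed.

(** By the Lipschitz bound and density, h v is the infimum of
    h(p) + L sum_i mdist (p i) (v i) over the sequences p with entries in a
    countable dense set, so the strict sublevel sets of h along u are countable
    unions of measurable sets. *)
Lemma measurable_lipschitz_seq (R : realType) (T : completeMetricType R)
    d (E : measurableType d) (k : nat) (u : nat -> E -> T)
    (h : (nat -> T) -> R) (L : R) :
  separable_space T -> 0 <= L ->
  (forall i, (i < k)%N -> measurable_fun setT (u i : E -> borel T)) ->
  (forall v v', `|h v - h v'| <= L * \sum_(i < k) mdist (v i) (v' i)) ->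
  measurable_fun setT (fun w => h (u ^~ w)).
Proof.
move=> /dense_sequence[q qd] L0 mu hL.
apply: (measurability _ (RGenInftyO.measurableE R)) => _ [_ [r ->] <-].
rewrite setTI.
pose p (s : seq nat) (i : nat) := q (nth 0%N s i).
have -> : (fun w => h (u ^~ w)) @^-1` `]-oo, r[ =
    \bigcup_(s : seq nat)
      [set w | h (p s) + L * \sum_(i < k) mdist (p s i) (u i w) < r].
  apply/seteqP; split => w; rewrite /= in_itv/=; last first.
    move=> [s _]/=; apply: le_lt_trans; rewrite addrC -lerBlDr.
    apply: (le_trans (ler_norm _)); apply: (le_trans (hL _ _)).
    by under eq_bigr do rewrite metric_sym.
  (* p at distance less than gap in each coordinate costs at most
     2 L k gap < r - h(u) *)
  move=> hr; pose gap := (r - h (u ^~ w)) / (2 * (L * k%:R + 1)).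
  have D0 : 0 < L * k%:R + 1 by rewrite ltr_wpDl// mulr_ge0.
  have gap0 : 0 < gap by rewrite divr_gt0 ?subr_gt0// mulr_gt0.
  have /choice[j jP] i := qd (u i w) _ gap0.
  exists (mkseq j k) => //=.
  have S : \sum_(i < k) mdist (p (mkseq j k) i) (u i w) <= k%:R * gap.
    rewrite mulr_natl -[k in leRHS]card_ord -sumr_const; apply: ler_sum => i _.
    by rewrite /p nth_mkseq// metric_sym ltW.
  have hp : h (p (mkseq j k)) - h (u ^~ w) <=
      L * \sum_(i < k) mdist (p (mkseq j k) i) (u i w).
    exact: le_trans (ler_norm _) (hL (p (mkseq j k)) (u ^~ w)).
  have LS := ler_wpM2l L0 S.
  have : 2 * (L * (k%:R * gap)) < r - h (u ^~ w).
    have -> : r - h (u ^~ w) = 2 * (L * k%:R + 1) * gap.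
      by rewrite /gap; field; rewrite gt_eqF.
    by rewrite -mulrA ltr_pM2l// mulrDl mulrA mul1r ltrDl.
  lra.
apply: countable_bigcupT_measurable; [exact: countableP|move=> s].
rewrite -[X in measurable X]setTI.
pose m w := h (p s) + L * \sum_(i < k) mdist (p s i) (u i w).
have mm : measurable_fun setT m.
  apply: measurable_funD => //; apply: measurable_funM => //.
  apply: measurable_sum => i.
  exact: (measurableT_comp (measurable_mdist (p s i)) (mu i (ltn_ord i))).
rewrite (_ : [set _ | _] = m @^-1` `]-oo, r[).
  by apply: mm => //; exact: measurable_itv.
by apply/seteqP; split => w; rewrite /= in_itv.
Qed.

(** * Mean distances *)

Section mean_distance.
Context (R : realType) (T : completeMetricType R) (C : R).
Context (mu : probability (borel T) R).
Hypothesis C_ge0 : 0 <= C.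

Let G := mean_scaled_dist C mu.

Lemma measurable_scaled_mdist (x : T) :
  measurable_fun setT ((fun y => C * mdist x y) : borel T -> R).
Proof. by apply: measurable_funM => //; exact: measurable_mdist. Qed.

Lemma mean_scaled_dist_ge0 x : (0 <= G x)%E.
Proof. by apply: integral_ge0 => y _; rewrite lee_fin mulr_ge0// mdist_ge0. Qed.

Lemma mean_scaled_dist_shift x x' : (G x <= (C * mdist x x')%:E + G x')%E.
Proof.
have c0 : (0 <= (C * mdist x x')%:E)%E by rewrite lee_fin mulr_ge0// mdist_ge0.
have -> : (C * mdist x x')%:E = (\int[mu]_(y in setT) (C * mdist x x')%:E)%E.
  by rewrite integral_cst//= probability_setT mule1.
rewrite /G /mean_scaled_dist -ge0_integralD//.
- apply: ge0_le_integral => //.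
  + by move=> y _; rewrite lee_fin mulr_ge0// mdist_ge0.
  + by apply/measurable_EFinP; exact: measurable_scaled_mdist.
  + apply/measurable_EFinP; apply: measurable_funD => //.
    exact: measurable_scaled_mdist.
  + by move=> y _; rewrite -EFinD lee_fin -mulrDr ler_wpM2l// metric_triangle.
- by move=> y _; rewrite lee_fin mulr_ge0// mdist_ge0.
- by apply/measurable_EFinP; exact: measurable_scaled_mdist.
Qed.

Context (x0 : T).
Hypothesis Gx0 : (G x0 < +oo)%E.

Lemma mean_scaled_dist_fin_num x : G x \is a fin_num.
Proof.
rewrite ge0_fin_numE ?mean_scaled_dist_ge0//.
by apply: (le_lt_trans (mean_scaled_dist_shift x x0)); rewrite lte_add_pinfty ?ltry.
Qed.

Lemma integrable_scaled_mdist x :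
  mu.-integrable setT (EFin \o (fun y : borel T => C * mdist x (y : T))).
Proof.
apply/integrableP; split; first by apply/measurable_EFinP; exact: measurable_scaled_mdist.
have := mean_scaled_dist_fin_num x; rewrite ge0_fin_numE ?mean_scaled_dist_ge0//.
apply: le_lt_trans; rewrite le_eqVlt; apply/orP; left; apply/eqP.
by apply: eq_integral => y _ /=; rewrite ger0_norm// mulr_ge0// mdist_ge0.
Qed.

Lemma fine_mean_scaled_dist x :
  fine (G x) = Rintegral mu setT (fun y : borel T => C * mdist x (y : T)).
Proof. by []. Qed.

Lemma fine_mean_scaled_dist_lip x x' :
  `|fine (G x) - fine (G x')| <= C * mdist x x'.
Proof.
have h z z' : fine (G z) <= C * mdist z z' + fine (G z').
  by rewrite -lee_fin EFinD !fineK ?mean_scaled_dist_fin_num// mean_scaled_dist_shift.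
by have := h x x'; have := h x' x; rewrite (metric_sym x' x) ler_norml; lra.
Qed.

End mean_distance.

(** Together with [mean_scaled_dist_shift], a finite second moment makes the mean
    distance finite at every point. *)
Lemma finite_somewhere (R : realType) d (Omega : measurableType d)
    (P : probability Omega R) (g : Omega -> \bar R) (V : R) :
  (\int[P]_w g w ^+ 2 <= V%:E)%E -> exists w, (g w < +oo)%E.
Proof.
move=> gV; apply: contrapT => /forallNP gy.
suff : (\int[P]_w g w ^+ 2 = +oo)%E by move=> E; rewrite E leye_eq in gV.
have -> : (\int[P]_w g w ^+ 2 = \int[P]_(w in setT) (cst +oo) w)%E.
  apply: eq_integral => w _; have := gy w.
  by rewrite ltNge leye_eq => /negP/negPn/eqP ->.
by rewrite integral_cst//= probability_setT mule1.
Qed.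

(** Averaging |h x - h x'| <= a C mdist x x' over x' gives the bound; it is how
    the functions G of the statement control the martingale differences. *)
Lemma lipschitz_centered (R : realType) (T : completeMetricType R) (C : R)
    (mu : probability (borel T) R) (x0 : T) (h : T -> R) (a : R) :
  0 <= C -> (mean_scaled_dist C mu x0 < +oo)%E -> 0 <= a ->
  (forall x x', `|h x - h x'| <= a * (C * mdist x x')) ->
  mu.-integrable setT (EFin \o (h : borel T -> R)) /\
  forall x, `|h x - Rintegral mu setT (h : borel T -> R)|
            <= a * fine (mean_scaled_dist C mu x).
Proof.
move=> C0 Gx0 a0 hL.
have mh : measurable_fun setT (h : borel T -> R).
  by apply: (@measurable_lipschitz _ _ _ (a * C)) => x x'; rewrite -mulrA hL.
have iM x : mu.-integrable setT (EFin \o (fun y : borel T => a * (C * mdist x (y : T)))).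
  exact: (integrableZl measurableT a (integrable_scaled_mdist C0 Gx0 x)).
have ic (c : R) : mu.-integrable setT (EFin \o (fun=> c)).
  exact: finite_measure_integrable_cst.
have ih : mu.-integrable setT (EFin \o (h : borel T -> R)).
  apply: (le_integrable measurableT _ _ (integrableD measurableT (ic `|h x0|) (iM x0))).
    exact/measurable_EFinP.
  move=> x _ /=; rewrite lee_fin.
  rewrite [leRHS]ger0_norm ?addr_ge0 ?mulr_ge0 ?mdist_ge0//.
  have := hL x0 x; have := ler_normB (h x0) (h x0 - h x).
  by rewrite opprB addrCA subrr addr0; lra.
split=> // x.
have -> : h x - Rintegral mu setT h = Rintegral mu setT (fun y => h x - h y).
  by rewrite RintegralB// Rintegral_cst//= probability_setT/= mulr1.
have iB : mu.-integrable setT (EFin \o (fun y : borel T => h x - h y)).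
  exact: (integrableB measurableT (ic (h x)) ih).
apply: (le_trans (le_normr_Rintegral measurableT iB)).
rewrite fine_mean_scaled_dist -RintegralZl//; last exact: (integrable_scaled_mdist C0 Gx0).
by apply: le_Rintegral => //; exact: integrable_norm.
Qed.

(** * Clipped centered functions *)

Lemma integrable_sqr (R : realType) d (E : measurableType d)
    (mu : probability E R) (G : E -> R) (V : R) :
  measurable_fun setT G -> (\int[mu]_w ((G w) ^+ 2)%:E <= V%:E)%E ->
  mu.-integrable setT (EFin \o (fun w => G w ^+ 2)).
Proof.
move=> mG GV; apply/integrableP; split.
  by apply/measurable_EFinP; exact: measurable_funX.
apply: (le_lt_trans _ (ltry V)); apply: le_trans GV.
rewrite le_eqVlt; apply/orP; left; apply/eqP; apply: eq_integral => w _ /=.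
by rewrite ger0_norm ?sqr_ge0.
Qed.

Lemma integrable_of_sqr (R : realType) d (E : measurableType d)
    (mu : probability E R) (G : E -> R) (V : R) :
  measurable_fun setT G -> (\int[mu]_w ((G w) ^+ 2)%:E <= V%:E)%E ->
  mu.-integrable setT (EFin \o G).
Proof.
move=> mG GV.
have iG2 := integrable_sqr mG GV.
have i1 : mu.-integrable setT (EFin \o (fun=> 1 : R)).
  exact: finite_measure_integrable_cst.
apply: (le_integrable measurableT _ _ (integrableD measurableT i1 iG2)).
  exact/measurable_EFinP.
move=> w _ /=; rewrite lee_fin [leRHS]ger0_norm ?addr_ge0 ?sqr_ge0//.
by rewrite -(real_normK (num_real (G w))); have := sqr_ge0 (`|G w| - 1); nra.
Qed.

(** Discarding the large values, instead of lowering them to M, keeps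
    clip M z <= z / M, so that clipping a centered function leaves a nonpositive
    mean. *)
Definition clip (R : realType) (M z : R) := if z <= M then z / M else 0.

Lemma measurable_clip (R : realType) (M : R) : measurable_fun setT (clip M).
Proof.
apply: measurable_fun_ifT => //; first exact: measurable_fun_ler.
exact: measurable_funM.
Qed.

Lemma clip_le1 (R : realType) (M z : R) : 0 < M -> clip M z <= 1.
Proof.
by move=> M0; rewrite /clip; case: (leP z M) => /= zM; rewrite ?ler01// ler_pdivrMr// mul1r.
Qed.

Lemma clip_le (R : realType) (M z : R) : 0 < M -> clip M z <= z / M.
Proof.
move=> M0; rewrite /clip; case: (leP z M) => /= zM; first exact: lexx.
by rewrite divr_ge0// ltW// (lt_trans M0).
Qed.

Lemma clip_sqr_le (R : realType) (M z g : R) : 0 < M -> `|z| <= g ->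
  clip M z ^+ 2 <= g ^+ 2 / M ^+ 2.
Proof.
move=> M0 zg; have g0 : 0 <= g by exact: le_trans zg.
rewrite /clip; case: (leP z M) => /= _; last by rewrite expr0n/= divr_ge0 ?sqr_ge0.
by rewrite expr_div_n ler_wpM2r ?invr_ge0 ?sqr_ge0// -real_normK ?num_real// lerXn2r ?nnegrE.
Qed.

(** The quadratic bound at xi = clip M D is at most
    a + b D / M + c (al G / M)^2, where the middle term integrates to 0: this
    uses b, c >= 0. *)
Lemma clip_mgf_le (R : realType) d (E : measurableType d)
    (mu : probability E R) (D G : E -> R) (al M V t a b c : R) :
  measurable_fun setT D -> measurable_fun setT G ->
  (forall w, `|D w| <= al * G w) ->
  mu.-integrable setT (EFin \o D) -> Rintegral mu setT D = 0 ->
  (\int[mu]_w ((G w) ^+ 2)%:E <= V%:E)%E ->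
  0 < M -> 0 <= b -> 0 <= c ->
  (forall xi, xi <= 1 -> expR (t * xi) <= a + b * xi + c * xi ^+ 2) ->
  (\int[mu]_w (expR (t * clip M (D w)))%:E <=
    (a + c * (V * al ^+ 2 / M ^+ 2))%:E)%E.
Proof.
move=> mD mG DG iD D0 GV M0 b0 c0 abc.
have iG2 := integrable_sqr mG GV.
pose k := c * (al ^+ 2 / M ^+ 2).
have k0 : 0 <= k by rewrite mulr_ge0// divr_ge0// sqr_ge0.
have mexp : measurable_fun setT (fun w => expR (t * clip M (D w))).
  apply: measurableT_comp => //; apply: measurable_funM => //.
  by apply: measurableT_comp => //; exact: measurable_clip.
pose q w := a + (b / M * D w + k * G w ^+ 2).
have iq1 : mu.-integrable setT (EFin \o (fun w => b / M * D w)).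
  exact: (integrableZl measurableT (b / M) iD).
have iq2 : mu.-integrable setT (EFin \o (fun w => k * G w ^+ 2)).
  exact: (integrableZl measurableT k iG2).
have iq12 : mu.-integrable setT (EFin \o (fun w => b / M * D w + k * G w ^+ 2)).
  exact: (integrableD _ iq1 iq2).
have ia : mu.-integrable setT (EFin \o (fun=> a)).
  exact: finite_measure_integrable_cst.
have iq : mu.-integrable setT (EFin \o q) by exact: (integrableD _ ia iq12).
have expq w : expR (t * clip M (D w)) <= q w.
  apply: (le_trans (abc _ (clip_le1 _ M0))); rewrite /q -addrA lerD2l lerD//.
    by rewrite -mulrA (mulrC _^-1) ler_wpM2l// clip_le.
  rewrite /k -mulrA ler_wpM2l//; apply: (le_trans (clip_sqr_le M0 (DG w))).
  by rewrite exprMn mulrAC.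
apply: (@le_trans _ _ (\int[mu]_w (q w)%:E)%E).
  apply: ge0_le_integral => //.
  - exact/measurable_EFinP.
  - by have /integrableP[mq _] := iq; exact: mq.
  - by move=> w _; rewrite lee_fin.
have -> : (\int[mu]_w (q w)%:E = (Rintegral mu setT q)%:E)%E.
  by rewrite fineK//; exact: integrable_fin_num.
rewrite lee_fin RintegralD// RintegralD// Rintegral_cst// RintegralZl// D0.
rewrite RintegralZl//= probability_setT mulr1 mulr0 add0r lerD2l.
have GV' : Rintegral mu setT (fun w => G w ^+ 2) <= V.
  by rewrite -lee_fin fineK//; exact: integrable_fin_num.
by rewrite (_ : c * _ = k * V) ?ler_wpM2l// /k; ring.
Qed.

(** * Integration of a fresh innovation given the past *)

Section history.
Local Open Scope ereal_scope.
Context (R : realType) d d1 d2 (Omega : measurableType d)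
  (E1 : measurableType d1) (E2 : measurableType d2) (P : probability Omega R).
Context (X1 : {RV P >-> E1}) (eps : nat -> {RV P >-> E2}).

(** A family closed under intersection that generates the sigma-algebra of X1 and
    of the eps i for i in J. *)
Definition rectangles (J : {fset nat}) : set (set Omega) :=
  [set W | exists A B, [/\ measurable A, (forall i, measurable (B i)) &
    W = X1 @^-1` A `&` \bigcap_(i in [set` J]) (eps i @^-1` B i)]].

(** Omega with the smaller sigma-algebra: measurability on this type
    expresses dependence on X1 and on the eps i with i in J alone. *)
Definition history (J : {fset nat}) := g_sigma_algebraType (rectangles J).

Lemma rectangles_setI J : setI_closed (rectangles J).
Proof.
move=> _ _ [A [B [mA mB ->]]] [A' [B' [mA' mB' ->]]].
exists (A `&` A'), (fun i => B i `&` B' i); split.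
- exact: measurableI.
- by move=> i; exact: measurableI.
- by rewrite setIACA preimage_setI -bigcapI.
Qed.

Lemma rectangles_setT J : rectangles J setT.
Proof.
exists setT, (fun=> setT); split => //.
by rewrite preimage_setT setTI; apply/esym/seteqP; split.
Qed.

Lemma measurable_rv_preimage d' (E : measurableType d') (Y : {RV P >-> E}) (A : set E) :
  measurable A -> measurable (Y @^-1` A).
Proof. by move=> mA; rewrite -[X in measurable X]setTI; exact: measurable_funP. Qed.

Lemma rectangles_measurable J : rectangles J `<=` measurable.
Proof.
move=> _ [A [B [mA mB ->]]]; apply: measurableI; first exact: measurable_rv_preimage.
apply: bigcap_measurableType => // i _; exact: measurable_rv_preimage.
Qed.

Lemma history_measurable J (A : set Omega) :
  measurable (A : set (history J)) -> measurable A.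
Proof.
by apply: smallest_sub; [exact: sigma_algebra_measurable|exact: rectangles_measurable].
Qed.

Lemma history_id_measurable J :
  measurable_fun setT (id : Omega -> history J).
Proof. by move=> _ A mA; rewrite setTI preimage_id; exact: history_measurable mA. Qed.

Lemma history_X1_measurable J : measurable_fun setT (X1 : history J -> E1).
Proof.
move=> _ A mA; rewrite setTI; apply: sub_sigma_algebra.
exists A, (fun=> setT); split => //.
by rewrite [X in _ `&` X](_ : _ = setT) ?setIT//; apply/seteqP; split.
Qed.

Lemma history_eps_measurable J i : i \in J ->
  measurable_fun setT (eps i : history J -> E2).
Proof.
move=> iJ _ A mA; rewrite setTI; apply: sub_sigma_algebra.
exists setT, (fun j => if j == i then A else setT); split => //.
  by move=> j; case: ifP.
rewrite preimage_setT setTI; apply/seteqP; split => w /=.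
  by move=> Aw j _ /=; case: eqP => // ->.
by move=> /(_ i iJ)/=; rewrite eqxx.
Qed.

Hypothesis eps_indep : mutually_independent [set i | (1 <= i)%N] eps.
Hypothesis X1_indep : independent_of_family X1 [set i | (2 <= i)%N] eps.

(** Peeling off X1 by its independence of the whole family, then applying the
    product rule to J with and without j. *)
Lemma rectangle_indep (J : {fset nat}) (j : nat) W B :
  (forall i, i \in J -> (2 <= i)%N) -> (2 <= j)%N -> j \notin J ->
  rectangles J W -> measurable B ->
  P (W `&` eps j @^-1` B) = P W * P (eps j @^-1` B).
Proof.
move=> J2 j2 jJ [A [C [mA mC ->]]] mB.
pose C' i := if i == j then B else C i.
have mC' i : measurable (C' i) by rewrite /C'; case: ifP.
have CC' : \bigcap_(i in [set` J]) (eps i @^-1` C i) =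
           \bigcap_(i in [set` J]) (eps i @^-1` C' i).
  apply: eq_bigcapr => i iJ; rewrite /C'; case: eqP => // ij.
  by move: jJ; rewrite -ij iJ.
have BC' : eps j @^-1` B = eps j @^-1` C' j by rewrite /C' eqxx.
have indep (J' : {fset nat}) : (forall i, i \in J' -> (2 <= i)%N) ->
    P (X1 @^-1` A `&` \bigcap_(i in [set` J']) (eps i @^-1` C' i)) =
    P (X1 @^-1` A) * \prod_(i <- J') P (eps i @^-1` C' i).
  move=> J'2; rewrite X1_indep//.
  - rewrite eps_indep// => i /= iJ'; exact: ltnW (J'2 i iJ').
  - by exists A => //; rewrite setTI.
  - apply: (@bigcap_measurableType _ (g_sigma_algebraType
      (\bigcup_(i in [set i | (2 <= i)%N]) preimage_set_system setT (eps i) measurable))).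
    move=> i iJ'; apply: sub_sigma_algebra; exists i; first exact: J'2.
    by exists (C' i) => //; rewrite setTI.
have jJE : \bigcap_(i in [set` (j |` J)%fset]) (eps i @^-1` C' i) =
    eps j @^-1` C' j `&` \bigcap_(i in [set` J]) (eps i @^-1` C' i).
  by rewrite set_fsetU1 bigcap_setU1.
rewrite CC' BC' -setIA (setIC (\bigcap_(i in _) _)) -jJE !indep//; last first.
  by move=> i /fset1UP[->//|]; exact: J2.
by rewrite big_fsetU1//= -muleA (muleC (\prod_(i <- J) _)).
Qed.

(** Two finite measures in A that agree on the generating rectangles. *)
Lemma history_indep (J : {fset nat}) (j : nat) (A : set Omega) B :
  (forall i, i \in J -> (2 <= i)%N) -> (2 <= j)%N -> j \notin J ->
  measurable (A : set (history J)) -> measurable B ->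
  P (A `&` eps j @^-1` B) = P A * P (eps j @^-1` B).
Proof.
move=> J2 j2 jJ mA mB.
have mE := measurable_rv_preimage (eps j) mB.
have p0 : (0 <= fine (P (eps j @^-1` B)))%R by rewrite fine_ge0.
pose m1 := mrestr P mE; pose m2 := mscale (NngNum p0) P.
have -> : P A * P (eps j @^-1` B) = m2 A.
  by rewrite /m2 /mscale/= fineK ?fin_num_measure// muleC.
apply: (@g_sigma_algebra_measure_unique _ R Omega (rectangles J)
  (@rectangles_measurable J) (fun=> setT) _ _ m1 m2) => //.
- by move=> _; exact: rectangles_setT.
- by apply/seteqP; split => // w _; exists 0%N.
- exact: rectangles_setI.
- move=> W rW; transitivity (P (W `&` eps j @^-1` B)); first by [].
  transitivity ((fine (P (eps j @^-1` B)))%:E * P W); last by [].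
  by rewrite (rectangle_indep J2 j2 jJ rW mB) fineK ?fin_num_measure// muleC.
- move=> _; rewrite /m1 /mrestr; apply: le_lt_trans (ltry 1).
  by apply: probability_le1; exact: measurableI.
Qed.

(** Integration with respect to the conditional law of eps j given the history:
    the pair (w, eps j w) has a product law, and Tonelli's theorem applies. *)
Lemma integral_history_eps (J : {fset nat}) (j : nat)
    (phi : history J * E2 -> \bar R) :
  (forall i, i \in J -> (2 <= i)%N) -> (2 <= j)%N -> j \notin J ->
  measurable_fun setT phi -> (forall z, 0 <= phi z) ->
  \int[P]_w phi (w, eps j w) = \int[P]_w \int[distribution P (eps j)]_y phi (w, y).
Proof.
move=> J2 j2 jJ mphi phi0.
pose idH : {mfun Omega >-> history J} :=
  HB.pack (id : Omega -> history J)
   (isMeasurableFun.Build _ _ _ _ _ (@history_id_measurable J)).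
have mpair : measurable_fun setT ((fun w => (w, eps j w)) : Omega -> history J * E2).
  apply: measurable_fun_pair; first exact: history_id_measurable.
  exact: measurable_funP.
pose pairH : {mfun Omega >-> (history J * E2)%type} :=
  HB.pack ((fun w => (w, eps j w)) : Omega -> history J * E2)
   (isMeasurableFun.Build _ _ _ _ _ mpair).
transitivity (\int[distribution P pairH]_z phi z).
  by rewrite ge0_integral_distribution.
transitivity (\int[distribution P idH \x distribution P (eps j)]_z phi z).
  apply: eq_measure_integral => W mW _; apply/esym.
  apply: product_measure_unique => // A B mA mB.
  by rewrite /distribution /pushforward/= -(history_indep J2 j2 jJ mA mB).
rewrite fubini_tonelli1// ge0_integral_distribution//.
- exact: measurable_fun_fubini_tonelli_F.
- by move=> w; exact: integral_ge0.
Qed.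

End history.

(** * Martingale decomposition along the chain *)

Lemma Kgeo_ge0 (R : realType) (k : nat) (rho : R) : 0 <= rho -> 0 <= Kgeo k rho.
Proof. by move=> r0; apply: sumr_ge0 => i _; exact: exprn_ge0. Qed.

Lemma Kgeo0 (R : realType) (rho : R) : Kgeo 0 rho = 1.
Proof. by rewrite /Kgeo big_nat1 expr0. Qed.

Lemma KgeoS (R : realType) (k : nat) (rho : R) :
  Kgeo k.+1 rho = 1 + rho * Kgeo k rho.
Proof.
rewrite /Kgeo big_nat_recl// expr0 big_distrr/=; congr (_ + _).
by apply: eq_bigr => i _; rewrite exprS.
Qed.

Lemma Kgeo_le (R : realType) (k m : nat) (rho : R) : 0 <= rho -> (k <= m)%N ->
  Kgeo k rho <= Kgeo m rho.
Proof.
move=> r0 km; rewrite /Kgeo [leRHS](big_cat_nat (leq0n k.+1))//= lerDl.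
by apply: sumr_ge0 => i _; exact: exprn_ge0.
Qed.

Section markov_chain.
Context (R : realType) (TX TY : completeMetricType R)
  (sepX : separable_space TX)
  d (Omega : measurableType d) (P : probability Omega R)
  (eps : nat -> {RV P >-> borel TY}) (X : nat -> {RV P >-> borel TX}).
Hypothesis eps_indep : mutually_independent [set i | (1 <= i)%N] eps.
Hypothesis eps_ident : identically_distributed [set i | (1 <= i)%N] eps.
Hypothesis X1_indep : independent_of_family (X 1%N) [set i | (2 <= i)%N] eps.
Context (F : TX * TY -> TX).
Hypothesis mF : measurable_fun [set: borel TX * borel TY]
          (F : borel TX * borel TY -> borel TX).
Hypothesis chain : forall k, (2 <= k)%N ->
     forall w, X k w = F (X k.-1 w, eps k w).
Context (rho C : R).
Hypotheses (rho_ge0 : 0 <= rho) (C_gt0 : 0 < C).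
Hypothesis F_contr : forall x x' : TX,
     ('E_P[fun w => mdist (F (x, eps 1%N w)) (F (x', eps 1%N w))]
        <= (rho * mdist x x')%:E)%E.
Hypothesis F_lip : forall (x : TX) (y y' : TY),
     mdist (F (x, y)) (F (x, y')) <= C * mdist y y'.

Let mu := distribution P (X 1%N).
Let nu := distribution P (eps 1%N).

Context (x0 : TX) (y0 : TY).
Hypothesis Gx0 : (mean_scaled_dist 1 mu x0 < +oo)%E.
Hypothesis Gy0 : (mean_scaled_dist C nu y0 < +oo)%E.

Let Gx (x : TX) : R := fine (mean_scaled_dist 1 mu x).
Let Ge (y : TY) : R := fine (mean_scaled_dist C nu y).

Let C_ge0 : 0 <= C. Proof. exact: ltW. Qed.

(** The class of functions of the first k+1 coordinates that is stable under
    averaging out the last one: only the last coordinate carries a coefficient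
    other than 1. *)
Definition last_lip (k : nat) (a : R) (f : (nat -> TX) -> R) :=
  forall u u', `|f u - f u'| <=
    \sum_(i < k) mdist (u i) (u' i) + a * mdist (u k) (u' k).

Definition upd (u : nat -> TX) (k : nat) (x : TX) : nat -> TX :=
  fun i => if i == k then x else u i.

Definition step (k : nat) (f : (nat -> TX) -> R) (u : nat -> TX) (y : TY) : R :=
  f (upd u k.+1 (F (u k, y))).

(** At u = (X_1, X_2, ...) this is the conditional expectation of f given X_1
    and eps_2, ..., eps_(k+1). *)
Definition average (k : nat) (f : (nat -> TX) -> R) (u : nat -> TX) : R :=
  Rintegral nu setT (step k f u : borel TY -> R).

Lemma step_lip k a f u : 0 <= a -> last_lip k.+1 a f ->
  forall y y', `|step k f u y - step k f u y'| <= a * (C * mdist y y').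
Proof.
move=> a0 fL y y'; apply: (le_trans (fL _ _)); rewrite big1 => [|i _].
  by rewrite add0r /upd eqxx ler_wpM2l.
by rewrite /upd (ltn_eqF (ltn_ord i)) mdistxx.
Qed.

(** The integrability holds because the distance is a Lipschitz function of y. *)
Lemma mean_contraction x x' :
  nu.-integrable setT
    (EFin \o (fun y : borel TY => mdist (F (x, y : TY)) (F (x', y : TY)))) /\
  Rintegral nu setT (fun y : borel TY => mdist (F (x, y : TY)) (F (x', y : TY)))
    <= rho * mdist x x'.
Proof.
pose h (y : TY) := mdist (F (x, y)) (F (x', y)).
have hL y y' : `|h y - h y'| <= 2 * (C * mdist y y').
  have := mdist_lip (F (x, y)) (F (x', y)) (F (x', y')).
  have := mdist_lip (F (x', y')) (F (x, y)) (F (x, y')).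
  rewrite (metric_sym _ (F (x, y))) (metric_sym _ (F (x, y'))).
  have := ler_normD (h y - mdist (F (x, y)) (F (x', y')))
    (mdist (F (x, y)) (F (x', y')) - h y').
  rewrite addrA subrK /h; have := F_lip x y y'; have := F_lip x' y y'; lra.
have [ih _] := lipschitz_centered C_ge0 Gy0 (ler0n R 2) hL.
split => //; rewrite -lee_fin fineK; last exact: integrable_fin_num.
apply: le_trans (F_contr x x').
rewrite unlock ge0_integral_distribution//=.
  by have /integrableP[] := ih.
by move=> y; rewrite lee_fin mdist_ge0.
Qed.

(** Averaging merges the last coordinate into the previous one: the distance
    between F (u k, y) and F (u' k, y) is at most rho mdist (u k) (u' k) on
    average. *)
Lemma average_lip k a f : 0 <= a -> last_lip k.+1 a f ->
  last_lip k (1 + rho * a) (average k f).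
Proof.
move=> a0 fL u u'.
have [iu _] := lipschitz_centered C_ge0 Gy0 a0 (step_lip u a0 fL).
have [iu' _] := lipschitz_centered C_ge0 Gy0 a0 (step_lip u' a0 fL).
have [ic Fc] := mean_contraction (u k) (u' k).
have iB : nu.-integrable setT
    (EFin \o (fun y : borel TY => step k f u y - step k f u' y)).
  exact: (integrableB measurableT iu iu').
rewrite /average -RintegralB//.
apply: (le_trans (le_normr_Rintegral measurableT iB)).
pose s := \sum_(i < k.+1) mdist (u i) (u' i).
have is_ : nu.-integrable setT (EFin \o (fun=> s)).
  exact: finite_measure_integrable_cst.
have ia : nu.-integrable setT (EFin \o (fun y : borel TY =>
    a * mdist (F (u k, y : TY)) (F (u' k, y : TY)))).
  exact: (integrableZl measurableT a ic).
apply: (@le_trans _ _ (Rintegral nu setT (fun y : borel TY =>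
    s + a * mdist (F (u k, y : TY)) (F (u' k, y : TY))))).
  apply: le_Rintegral => //; first exact: integrable_norm.
    exact: (integrableD measurableT is_ ia).
  move=> y _; apply: (le_trans (fL _ _)).
  rewrite /upd eqxx lerD2r /s le_eqVlt; apply/orP; left; apply/eqP.
  by apply: eq_bigr => i _; rewrite (ltn_eqF (ltn_ord i)).
rewrite RintegralD// RintegralZl// Rintegral_cst//= probability_setT/= mulr1.
rewrite /s big_ord_recr/= -addrA lerD2l mulrDl mul1r lerD2l.
by rewrite (mulrC rho) -mulrA ler_wpM2l.
Qed.

Lemma last_lip_le k a f : 0 <= a -> last_lip k a f ->
  forall v v', `|f v - f v'| <= (1 + a) * \sum_(i < k.+1) mdist (v i) (v' i).
Proof.
move=> a0 fL v v'; apply: (le_trans (fL v v')).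
rewrite big_ord_recr/= mulrDr; apply: lerD.
  by rewrite ler_peMl ?lerDl// sumr_ge0// => i _; exact: mdist_ge0.
by rewrite ler_wpM2r ?mdist_ge0// lerDr.
Qed.

Definition trajectory (w : Omega) : nat -> TX := fun i => X i.+1 w.

(** With coordinates of the trajectory counted from 0, its first k+1 states are
    X_1, ..., X_(k+1) and involve the innovations of index 2 to k+1. *)
Definition past (k : nat) : {fset nat} := [fset i | i in iota 2 k]%fset.

Lemma in_past k i : (i \in past k) = (2 <= i < k.+2)%N.
Proof. by rewrite !inE/= mem_iota add2n. Qed.

Definition past_type k := history (X 1%N) eps (past k).

Lemma past_chain_measurable k i : (i <= k)%N ->
  measurable_fun setT (X i.+1 : past_type k -> borel TX).
Proof.
elim: i => [_|i IH ik]; first exact: history_X1_measurable.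
have -> : (X i.+2 : past_type k -> borel TX) =
    (F : borel TX * borel TY -> borel TX) \o (fun w => (X i.+1 w, eps i.+2 w)).
  by apply/funext => w; rewrite chain.
apply: measurableT_comp; first exact: mF.
apply: measurable_fun_pair; first exact: IH (ltnW ik).
by apply: history_eps_measurable; rewrite in_past/= !ltnS.
Qed.

Lemma past_lip_measurable k a f : 0 <= a -> last_lip k a f ->
  measurable_fun setT (fun w : past_type k => f (trajectory w)).
Proof.
move=> a0 fL.
apply: (@measurable_lipschitz_seq _ TX _ (past_type k) k.+1 (fun i w => X i.+1 w) f (1 + a)) => //.
- by rewrite addr_ge0.
- by move=> i; rewrite ltnS; exact: past_chain_measurable.
- exact: last_lip_le.
Qed.

Lemma past_step_measurable k a f : 0 <= a -> last_lip k.+1 a f ->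
  measurable_fun setT
    (fun z : past_type k * borel TY => step k f (trajectory z.1) (z.2 : TY)).
Proof.
move=> a0 fL.
apply: (@measurable_lipschitz_seq _ TX _ (past_type k * borel TY)%type k.+2
  (fun i z => upd (trajectory z.1) k.+1 (F (trajectory z.1 k, z.2)) i) f (1 + a)) => //.
- by rewrite addr_ge0.
- move=> i ik; rewrite /upd; case: eqP => [_|/eqP ik1].
    apply: (measurableT_comp mF); apply: measurable_fun_pair => //.
    by apply: (measurableT_comp (past_chain_measurable (leqnn k))).
  apply: (measurableT_comp (past_chain_measurable _)) => //.
  by rewrite -ltnS ltn_neqAle ik1 -ltnS.
- exact: last_lip_le.
Qed.

Lemma trajectory_step k f w : f (trajectory w) = step k f (trajectory w) (eps k.+2 w).
Proof.
congr f; apply/funext => i; rewrite /upd; case: eqP => // ->.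
by rewrite /trajectory chain.
Qed.

Lemma past_shrink k : measurable_fun setT (id : past_type k.+1 -> past_type k).
Proof.
move=> _ A mA; rewrite setTI preimage_id; move: A mA.
apply: smallest_sub; first exact: sigma_algebra_measurable.
move=> _ [A [B [mA mB ->]]]; apply: sub_sigma_algebra.
exists A, (fun i => if i \in past k then B i else setT); split => //.
  by move=> i; case: ifP.
congr (_ `&` _); apply/seteqP; split => w Bw i /= ip.
  by case: ifP => // ik; exact: Bw.
have := Bw i; rewrite /= ip; apply.
by move: ip; rewrite !in_past => /andP[-> /ltnW].
Qed.

Lemma past_measurable k d' (E : measurableType d') (h : Omega -> E) :
  measurable_fun setT (h : past_type k -> E) -> measurable_fun setT h.
Proof.
move=> mh; apply: (@measurableT_comp _ _ _ _ _ _ (h : past_type k -> E)) => //.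
exact: history_id_measurable.
Qed.

Lemma integral_eps j (h : borel TY -> \bar R) : (1 <= j)%N ->
  (\int[distribution P (eps j)]_y h y = \int[nu]_y h y)%E.
Proof. by move=> j1; apply: eq_measure_integral => A mA _; exact: eps_ident. Qed.

Lemma Ge_measurable : measurable_fun setT (Ge : borel TY -> R).
Proof.
apply: (@measurable_lipschitz _ _ _ C) => x x'.
exact: (fine_mean_scaled_dist_lip C_ge0 Gy0).
Qed.

Lemma Gx_measurable : measurable_fun setT (Gx : borel TX -> R).
Proof.
apply: (@measurable_lipschitz _ _ _ 1) => x x'.
exact: (fine_mean_scaled_dist_lip ler01 Gx0).
Qed.

Lemma Ge_ge0 z : 0 <= Ge z.
Proof. by rewrite fine_ge0// mean_scaled_dist_ge0. Qed.

Context (N : nat) (M y V1 V2 : R).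
Hypothesis M_gt0 : 0 < M.
Hypothesis KyM : forall m, (m <= N)%N -> Kgeo m rho * y <= M.
Hypothesis HV1 : (\int[mu]_x ((Gx x) ^+ 2)%:E <= V1%:E)%E.
Hypothesis HV2 : (\int[nu]_z ((Ge z) ^+ 2)%:E <= V2%:E)%E.

(** Bounds on the second moments of the clipped differences, the index 0 standing
    for the contribution of X_1 and i for that of eps_(i+1). *)
Definition step_var (i : nat) : R :=
  (if i is 0%N then V1 else V2) * (Kgeo (N - i) rho) ^+ 2 / M ^+ 2.

Lemma clip_exact z g m : (m <= N)%N -> `|z| <= Kgeo m rho * g -> g <= y ->
  M * clip M z = z.
Proof.
move=> mN zg gy.
have zM : z <= M.
  apply: (le_trans (ler_norm z)); apply: (le_trans zg).
  by apply: (le_trans _ (KyM mN)); rewrite ler_wpM2l ?Kgeo_ge0.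
by rewrite /clip zM mulrCA divff ?mulr1// gt_eqF.
Qed.

(** W stands for the sum of the clipped martingale differences of f.  The
    exponential bound is required for every quadratic at once, since the useful
    one is known only at the end; measurability with respect to the past is what
    lets the next innovation be integrated first. *)
Definition clipped_sum (k : nat) (f : (nat -> TX) -> R) (W : Omega -> R) :=
  [/\ measurable_fun setT (W : past_type k -> R),
      forall w, W w <= k.+1%:R,
      forall t a b c, 0 <= b -> 0 <= c ->
        (forall xi, xi <= 1 -> expR (t * xi) <= a + b * xi + c * xi ^+ 2) ->
        (\int[P]_w (expR (t * W w))%:E <=
           (\prod_(i < k.+1) (a + c * step_var i))%:E)%E,
      P.-integrable setT (EFin \o (fun w => f (trajectory w))) &
      forall w, Gx (X 1%N w) <= y ->
        (forall i, (2 <= i < k.+2)%N -> Ge (eps i w) <= y) ->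
        f (trajectory w) - Rintegral P setT (fun w => f (trajectory w)) = M * W w].

Lemma clipped_sum0 f : last_lip 0 (Kgeo N rho) f -> exists W, clipped_sum 0 f W.
Proof.
move=> fL; set a0 := Kgeo N rho in fL.
have a00 : 0 <= a0 by exact: Kgeo_ge0.
pose h (x : TX) := f (fun=> x).
have hL x x' : `|h x - h x'| <= a0 * (1 * mdist x x').
  by apply: (le_trans (fL _ _)); rewrite big_ord0 add0r mul1r.
have fh w : f (trajectory w) = h (X 1%N w).
  apply/eqP; rewrite -subr_eq0 -normr_le0; apply: (le_trans (fL _ _)).
  by rewrite big_ord0 add0r mdistxx mulr0.
have [ih hc] := lipschitz_centered ler01 Gx0 a00 hL.
set m := Rintegral mu setT h in hc.
have mh : measurable_fun setT (h : borel TX -> R).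
  by have /integrableP[/measurable_EFinP] := ih.
have fint : P.-integrable setT (EFin \o (fun w => f (trajectory w))).
  have -> : EFin \o (fun w => f (trajectory w)) = (EFin \o h) \o X 1%N.
    by apply/funext => w /=; rewrite fh.
  apply/integrableP; split.
    by apply: measurableT_comp => //; exact/measurable_EFinP.
  rewrite -(@ge0_integral_distribution _ _ _ _ _ P (X 1%N) (fun z => `|(h z)%:E|%E))//.
    by have /integrableP[] := ih.
  by apply: measurableT_comp => //; exact/measurable_EFinP.
have mE : Rintegral P setT (fun w => f (trajectory w)) = m.
  rewrite /m /Rintegral (integral_distribution (X := X 1%N))//=.
  - by congr fine; apply: eq_integral => w _ /=; rewrite fh.
  - exact/measurable_EFinP.
  - by apply: eq_integrable fint => // w _ /=; rewrite fh.
have im : mu.-integrable setT (EFin \o (fun=> m)).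
  exact: finite_measure_integrable_cst.
have mD : measurable_fun setT ((fun x => h x - m) : borel TX -> R).
  exact: measurable_funB.
have mW : measurable_fun setT ((fun w => clip M (h (X 1%N w) - m)) : past_type 0 -> R).
  apply: measurableT_comp; first exact: measurable_clip.
  by apply: (measurableT_comp mD); exact: history_X1_measurable.
exists (fun w => clip M (h (X 1%N w) - m)); split => //.
- by move=> w; exact: clip_le1.
- move=> t a b c b0 c0 abc; rewrite big_ord1.
  rewrite -(@ge0_integral_distribution _ _ _ _ _ P (X 1%N)
    (fun x => (expR (t * clip M (h x - m)))%:E))//.
  + rewrite /step_var subn0; apply: (clip_mgf_le mD Gx_measurable hc _ _ HV1 M_gt0 b0 c0 abc).
    * exact: (integrableB measurableT ih im).
    * rewrite RintegralB// Rintegral_cst//=.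
      by rewrite probability_setT/= mulr1 subrr.
  + apply/measurable_EFinP; apply: measurableT_comp => //.
    apply: measurable_funM => //; apply: measurableT_comp => //.
    exact: measurable_clip.
- move=> w Gy _; rewrite mE fh; apply/esym.
  exact: (clip_exact (leqnn N) (hc (X 1%N w)) Gy).
Qed.

Lemma integral_fresh k (phi : past_type k * borel TY -> \bar R) :
  measurable_fun setT phi -> (forall z, 0 <= phi z)%E ->
  (\int[P]_w phi (w, eps k.+2 w) = \int[P]_w \int[nu]_z phi (w, z))%E.
Proof.
move=> mphi phi0.
transitivity (\int[P]_w \int[distribution P (eps k.+2)]_z phi (w, z))%E; last first.
  by apply: eq_integral => w _; rewrite integral_eps.
apply: (@integral_history_eps _ _ _ _ _ _ _ P (X 1%N) eps eps_indep X1_indep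
  (past k) k.+2 phi) => //.
- by move=> i; rewrite in_past => /andP[].
- by rewrite in_past ltnn andbF.
Qed.

Lemma past_integral_measurable k (phi : past_type k * borel TY -> \bar R) :
  measurable_fun setT phi -> (forall z, 0 <= phi z)%E ->
  measurable_fun setT (fun w : Omega => \int[nu]_z phi (w, z))%E.
Proof.
move=> mphi phi0.
apply: (@past_measurable k _ _ (fun w : past_type k => \int[nu]_z phi (w, z))%E).
exact: measurable_fun_fubini_tonelli_F.
Qed.

(** The induction step adds to W' the clipped difference between f and its
    average.  Integrating out the fresh innovation, given the past, multiplies the
    exponential moment by at most a + c (step_var k.+1). *)
Lemma clipped_sumS k f W' : (k < N)%N ->
  last_lip k.+1 (Kgeo (N - k.+1) rho) f ->
  clipped_sum k (average k f) W' -> exists W, clipped_sum k.+1 f W.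
Proof.
move=> kN fL [mW' W'k W'exp gint W'E].
set a0 := Kgeo (N - k.+1) rho in fL.
have a00 : 0 <= a0 by exact: Kgeo_ge0.
pose g := average k f.
have gL : last_lip k (1 + rho * a0) g by exact: average_lip.
have ra0 : 0 <= 1 + rho * a0 by rewrite addr_ge0// mulr_ge0.
pose D w (z : TY) := step k f (trajectory w) z - g (trajectory w).
have DG w z : `|D w z| <= a0 * Ge z.
  by have [_] := lipschitz_centered C_ge0 Gy0 a00 (step_lip (trajectory w) a00 fL); exact.
have istep w : nu.-integrable setT (EFin \o (step k f (trajectory w) : borel TY -> R)).
  by have [] := lipschitz_centered C_ge0 Gy0 a00 (step_lip (trajectory w) a00 fL).
have icst (c : R) : nu.-integrable setT (EFin \o (fun=> c)).
  exact: finite_measure_integrable_cst.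
have iD w : nu.-integrable setT (EFin \o (D w : borel TY -> R)).
  exact: (integrableB measurableT (istep w) (icst _)).
have D0 w : Rintegral nu setT (D w : borel TY -> R) = 0.
  by rewrite RintegralB// Rintegral_cst//= probability_setT/= mulr1 subrr.
have mg : measurable_fun setT (fun w : past_type k => g (trajectory w)).
  exact: past_lip_measurable gL.
have mD2 : measurable_fun setT (fun p : past_type k * borel TY => D p.1 p.2).
  apply: measurable_funB; first exact: past_step_measurable fL.
  exact: (measurableT_comp mg measurable_fst).
have mD w : measurable_fun setT (D w : borel TY -> R).
  by have /integrableP[/measurable_EFinP] := iD w.
pose W w := W' w + clip M (D w (eps k.+2 w)).
have mWfresh (h : R -> R) : measurable_fun setT h ->
    measurable_fun setT (fun p : past_type k * borel TY => h (W' p.1 + clip M (D p.1 p.2))).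
  move=> mh; apply: (measurableT_comp mh); apply: measurable_funD.
    exact: (measurableT_comp mW' measurable_fst).
  by apply: (measurableT_comp (@measurable_clip _ M)).
have mDfresh : measurable_fun setT (fun w : past_type k.+1 => D w (eps k.+2 w)).
  have mpair : measurable_fun setT
      ((fun w => (w, eps k.+2 w)) : past_type k.+1 -> past_type k * borel TY).
    apply: measurable_fun_pair; first exact: past_shrink.
    by apply: history_eps_measurable; rewrite in_past/= !ltnS.
  exact: (measurableT_comp mD2 mpair).
have mGe : measurable_fun setT (fun w => Ge (eps k.+2 w)).
  by apply: (measurableT_comp Ge_measurable); exact: measurable_funP.
have iGe : P.-integrable setT (EFin \o (fun w => a0 * Ge (eps k.+2 w))).
  suff iG : P.-integrable setT (EFin \o (fun w => Ge (eps k.+2 w))).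
    exact: (integrableZl measurableT a0 iG).
  apply: (@integrable_of_sqr _ _ _ P _ V2) => //.
  rewrite -(@ge0_integral_distribution _ _ _ _ _ P (eps k.+2) (fun z => (Ge z ^+ 2)%:E))//.
    by rewrite integral_eps.
  - by apply/measurable_EFinP; apply: measurable_funX; exact: Ge_measurable.
  - by move=> z; rewrite lee_fin sqr_ge0.
have iDf : P.-integrable setT (EFin \o (fun w => D w (eps k.+2 w))).
  apply: (le_integrable measurableT _ _ iGe).
    by apply/measurable_EFinP; exact: past_measurable mDfresh.
  move=> w _ /=; rewrite lee_fin (le_trans (DG _ _))// ler_norm//.
have fE w : f (trajectory w) = g (trajectory w) + D w (eps k.+2 w).
  by rewrite /D addrC subrK -trajectory_step.
have fint : P.-integrable setT (EFin \o (fun w => f (trajectory w))).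
  have -> : EFin \o (fun w => f (trajectory w)) =
      (EFin \o (fun w => g (trajectory w))) \+ (EFin \o (fun w => D w (eps k.+2 w))).
    by apply/funext => w /=; rewrite -EFinD -fE.
  exact: integrableD.
have D0f : Rintegral P setT (fun w => D w (eps k.+2 w)) = 0.
  (* a nonnegative version of D, to which Tonelli's theorem applies *)
  pose H w z := D w z + a0 * Ge z.
  have H0 w z : 0 <= H w z.
    by have := DG w z; rewrite ler_norml /H => /andP[+ _]; lra.
  have iGn : nu.-integrable setT (EFin \o (fun z : borel TY => a0 * Ge z)).
    exact: (integrableZl measurableT a0 (integrable_of_sqr Ge_measurable HV2)).
  have : (\int[P]_w (H w (eps k.+2 w))%:E = \int[P]_w (a0 * Ge (eps k.+2 w))%:E)%E.
    transitivity (\int[P]_w \int[nu]_z (H w z)%:E)%E.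
      apply: (@integral_fresh k (fun p => (H p.1 p.2)%:E)).
        apply/measurable_EFinP; apply: measurable_funD => //.
        apply: measurable_funM => //.
        exact: (measurableT_comp Ge_measurable measurable_snd).
      by move=> p; rewrite lee_fin.
    transitivity (\int[P]_w \int[nu]_z (a0 * Ge z)%:E)%E.
      apply: eq_integral => w _.
      have -> : (\int[nu]_z (H w z)%:E = (Rintegral nu setT (H w))%:E)%E.
        rewrite fineK//; apply: integrable_fin_num => //.
        exact: (integrableD measurableT (iD w) iGn).
      rewrite RintegralD// D0 add0r fineK//.
      exact: (integrable_fin_num measurableT iGn).
    apply/esym; apply: (@integral_fresh k (fun p => (a0 * Ge p.2)%:E)).
      apply/measurable_EFinP; apply: measurable_funM => //.
      exact: (measurableT_comp Ge_measurable measurable_snd).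
    by move=> p; rewrite lee_fin mulr_ge0// Ge_ge0.
  move/(congr1 fine); rewrite -!/(Rintegral _ _ _) RintegralD//; lra.
exists W; split.
- apply: measurable_funD; first exact: (measurableT_comp mW' (@past_shrink k)).
  by apply: (measurableT_comp (@measurable_clip _ M)).
- by move=> w; rewrite -natr1 lerD// clip_le1.
- move=> t a b c b0 c0 abc; rewrite big_ord_recr/=.
  set Pi := \prod_(i < k.+1) _; set s := a + c * _.
  have step_le w : (\int[nu]_z (expR (t * clip M (D w z)))%:E <= s%:E)%E.
    exact: (clip_mgf_le (mD w) Ge_measurable (DG w) (iD w) (D0 w) HV2 M_gt0 b0 c0 abc).
  have s0 : 0 <= s.
    rewrite -lee_fin; apply: le_trans (step_le point).
    by apply: integral_ge0 => z _; rewrite lee_fin expR_ge0.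
  rewrite [X in (X <= _)%E](_ : _ = \int[P]_w \int[nu]_z
      (expR (t * (W' w + clip M (D w z))))%:E)%E; last first.
    apply: (@integral_fresh k (fun p => (expR (t * (W' p.1 + clip M (D p.1 p.2))))%:E)).
      apply/measurable_EFinP; apply: (mWfresh (fun r => expR (t * r))).
      by apply: measurableT_comp => //; exact: measurable_funM.
    by move=> p; rewrite lee_fin expR_ge0.
  have mexpW' : measurable_fun setT (fun w => expR (t * W' w)).
    apply: measurableT_comp => //; apply: measurable_funM => //.
    exact: past_measurable mW'.
  apply: (@le_trans _ _ (\int[P]_w ((expR (t * W' w))%:E * s%:E))%E).
    apply: ge0_le_integral => //.
    + by move=> w _; apply: integral_ge0 => z _; rewrite lee_fin expR_ge0.
    + apply: (@past_integral_measurable k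
        (fun p => (expR (t * (W' p.1 + clip M (D p.1 p.2))))%:E)).
        apply/measurable_EFinP; apply: (mWfresh (fun r => expR (t * r))).
        by apply: measurableT_comp => //; exact: measurable_funM.
      by move=> p; rewrite lee_fin expR_ge0.
    + by apply: emeasurable_funM => //; exact/measurable_EFinP.
    + move=> w _; under eq_integral do rewrite mulrDr expRD EFinM.
      rewrite ge0_integralZl//.
      * by rewrite lee_pmul2l ?lte_fin ?expR_gt0.
      * apply/measurable_EFinP; apply: measurableT_comp => //.
        apply: measurable_funM => //.
        exact: (measurableT_comp (@measurable_clip _ M) (mD w)).
  rewrite ge0_integralZr//; last exact/measurable_EFinP.
  by rewrite EFinM lee_wpmul2r ?lee_fin//; exact: (W'exp t a b c b0 c0 abc).
- exact: fint.
- move=> w Gxy Gey; rewrite /W mulrDr.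
  rewrite (@clip_exact _ _ _ _ (DG w (eps k.+2 w))); first last.
  + by apply: Gey; rewrite /= !ltnS.
  + exact: leq_subr.
  rewrite -(W'E w Gxy) => [|i /andP[i2 ik]]; last by rewrite Gey// i2 ltnW.
  have -> : Rintegral P setT (fun w => f (trajectory w)) =
      Rintegral P setT (fun w => g (trajectory w)).
    rewrite -[RHS]addr0 -D0f -RintegralD//.
    by apply: eq_Rintegral => v _; rewrite fE.
  by rewrite fE addrAC.
Qed.

(** The coefficient K_(N-k) becomes 1 + rho K_(N-k) = K_(N-k+1) for the average of
    f, so the induction on k runs along a fixed N. *)
Lemma clipped_sum_exists k f : (k <= N)%N -> last_lip k (Kgeo (N - k) rho) f ->
  exists W, clipped_sum k f W.
Proof.
elim: k f => [|k IH] f kN fL; first by apply: clipped_sum0; rewrite subn0 in fL.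
have [|W' W'P] := IH (average k f) (ltnW kN).
  by rewrite -subnSK// KgeoS; apply: average_lip => //; exact: Kgeo_ge0.
exact: clipped_sumS W'P.
Qed.

Definition excess : set Omega :=
  [set w | y < Gx (X 1%N w)] `|`
  \bigcup_(i in [set i | (2 <= i < N.+2)%N]) [set w | y < Ge (eps i w)].

Lemma excess_measurable : measurable excess.
Proof.
apply: measurableU.
  have mG : measurable_fun setT (fun w => Gx (X 1%N w)).
    by apply: (measurableT_comp Gx_measurable); exact: measurable_funP.
  by have [] := measurable_superlevel y mG.
apply: bigcup_measurable => i _.
have mG : measurable_fun setT (fun w => Ge (eps i w)).
  by apply: (measurableT_comp Ge_measurable); exact: measurable_funP.
by have [] := measurable_superlevel y mG.
Qed.

(** Off [excess] no difference is clipped, so the deviation is M W there. *)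
Lemma clipped_sum_tail f W x : clipped_sum N f W ->
  0 < x -> 0 < V1 -> 0 <= V2 ->
  (P [set w | (x < f (trajectory w) - Rintegral P setT (fun w => f (trajectory w)))%R] <=
   (Hn N.+1 (x / M) (Num.sqrt (V1 * Kgeo N rho ^+ 2 +
      V2 * \sum_(2 <= i < N.+2) Kgeo (N.+1 - i) rho ^+ 2) / M))%:E + P excess)%E.
Proof.
move=> [mW WN Wexp fint WE] x_gt0 V1_gt0 V2_ge0.
set V := V1 * _ + _; set m := Rintegral _ _ _.
have M2 : 0 <= (M ^+ 2)^-1 by rewrite invr_ge0 sqr_ge0.
have K1 : 1 <= Kgeo N rho by rewrite -(@Kgeo0 _ rho) Kgeo_le.
have V0 : 0 < V.
  apply: ltr_wpDr; last by rewrite mulr_gt0// exprn_gt0// (lt_le_trans ltr01).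
  by rewrite mulr_ge0// sumr_ge0// => i _; exact: sqr_ge0.
have varE : (Num.sqrt V / M) ^+ 2 = \sum_(i < N.+1) step_var i.
  rewrite expr_div_n sqr_sqrtr ?(ltW V0)// big_ord_recl/= /step_var subn0.
  rewrite /V mulrDl; congr (_ + _).
  rewrite big_add1/= big_add1/= big_mkord mulr_sumr mulr_suml.
  by apply: eq_bigr => i _; rewrite !subSS.
have mWO := past_measurable mW.
have mfm : measurable_fun setT (fun w => f (trajectory w) - m).
  apply: measurable_funB => //.
  by have /integrableP[/measurable_EFinP] := fint.
have [mL _] := measurable_superlevel x mfm.
have [mR _] := measurable_superlevel (x / M) mWO.
apply: (@le_trans _ _ (P ([set w | (x / M < W w)%R] `|` excess))).
  apply: le_measure; rewrite ?inE//.
    by apply: measurableU => //; exact: excess_measurable.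
  move=> w /= xw; have [|nb] := pselect (excess w); first by right.
  left; rewrite /= ltr_pdivrMr// mulrC -WE//.
  - by rewrite leNgt; apply/negP => yG; apply: nb; left.
  - by move=> i iN; rewrite leNgt; apply/negP => yG; apply: nb; right; exists i.
apply: (le_trans (measureU2 _ mR excess_measurable)).
apply: leeD => //; apply: (Hn_tail _ _ _ mWO WN _ varE Wexp) => //.
- by rewrite divr_gt0.
- by rewrite divr_gt0// sqrtr_gt0.
- move=> i; apply: mulr_ge0 => //; apply: mulr_ge0; last exact: sqr_ge0.
  by case: i => [|_]//; exact: ltW.
Qed.

End markov_chain.

(** * The deviation inequality *)

Lemma lt_bigmaxe (R : realType) (y : \bar R) (r : seq nat) (G : nat -> \bar R) :
  (y < \big[maxe/-oo]_(i <- r) G i)%E <-> exists2 i, i \in r & (y < G i)%E.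
Proof.
elim: r => [|j r IH]; first by rewrite big_nil; split => [|[]//]; rewrite ltNge leNye.
rewrite big_cons lt_max; split=> [/orP[yj|/IH[i ir yi]]|[i]].
- by exists j => //; rewrite mem_head.
- by exists i => //; rewrite inE ir orbT.
- rewrite inE => /predU1P[-> ->//|ir yi].
  by apply/orP; right; apply/IH; exists i.
Qed.

Theorem proposition3p7 (R : realType)
  (TX TY : completeMetricType R)
  (sepX : separable_space TX) (sepY : separable_space TY)
  (d : measure_display) (Omega : measurableType d) (P : probability Omega R)
  (* eps i is used for i >= 1 and X i for i >= 1; index 0 is irrelevant *)
  (eps : nat -> {RV P >-> borel TY})
  (eps_indep : mutually_independent [set i | (1 <= i)%N] eps)
  (eps_ident : identically_distributed [set i | (1 <= i)%N] eps)
  (X : nat -> {RV P >-> borel TX})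
  (X1_indep : independent_of_family (X 1%N) [set i | (2 <= i)%N] eps)
  (F : TX * TY -> TX)
  (mF : measurable_fun [set: borel TX * borel TY]
          (F : borel TX * borel TY -> borel TX))
  (chain : forall k, (2 <= k)%N ->
     forall w, X k w = F (X k.-1 w, eps k w))
  (rho C : R) (rho_ge0 : 0 <= rho) (rho_lt1 : rho < 1) (C_gt0 : 0 < C)
  (F_contr : forall x x' : TX,
     ('E_P[fun w => mdist (F (x, eps 1%N w)) (F (x', eps 1%N w))]
        <= (rho * mdist x x')%:E)%E)
  (F_lip : forall (x : TX) (y y' : TY),
     mdist (F (x, y)) (F (x, y')) <= C * mdist y y')
  (n : nat) (n_ge1 : (1 <= n)%N)
  (f : ('I_n -> TX) -> R)
  (f_lip : forall u u' : 'I_n -> TX,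
     `|f u - f u'| <= \sum_(i < n) mdist (u i) (u' i))
  (V1 V2 : R) (V1_gt0 : 0 < V1) (V2_gt0 : 0 < V2) :
  let fX : Omega -> R := fun w => f (fun i : 'I_n => X i.+1 w) in
  let S : Omega -> R := fun w => fX w - fine 'E_P[fX] in
  let GX1 : TX -> \bar R := mean_dist (distribution P (X 1%N)) in
  let Geps : TY -> \bar R := mean_scaled_dist C (distribution P (eps 1%N)) in
  let V : R := V1 * (Kgeo n.-1 rho) ^+ 2
               + V2 * \sum_(2 <= i < n.+1) (Kgeo (n - i) rho) ^+ 2 in
  (\int[P]_w (GX1 (X 1%N w)) ^+ 2 <= V1%:E)%E ->
  (\int[P]_w (Geps (eps 1%N w)) ^+ 2 <= V2%:E)%E ->
  forall (x y : R) (b : bool), 0 < x -> 0 < y ->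
  (P [set w | (x < (-1) ^+ b * S w)%R]
     <= (Hn n (x / (y * Kgeo n.-1 rho))
              (Num.sqrt V / (y * Kgeo n.-1 rho)))%:E
        + P [set w | (y%:E < maxe (GX1 (X 1%N w))
                       (\big[maxe/-oo]_(2 <= i < n.+1) Geps (eps i w)))])%E.
Proof.
case: n n_ge1 f f_lip => // N _ f f_lip fX S GX1 Geps V HV1 HV2 x y b x_gt0 y_gt0.
pose mu := distribution P (X 1%N); pose nu := distribution P (eps 1%N).
have GX1E z : GX1 z = mean_scaled_dist 1 mu z.
  by rewrite /GX1 /mean_dist; apply: eq_integral => z' _; rewrite mul1r.
have [w1 Gx0] := finite_somewhere HV1; rewrite GX1E in Gx0.
have [w2 Gy0] := finite_somewhere HV2.
have C_ge0 : 0 <= C by exact: ltW.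
have GXf z : GX1 z = (fine (mean_scaled_dist 1 mu z))%:E.
  by rewrite GX1E fineK// (mean_scaled_dist_fin_num ler01 Gx0).
have Gef z : Geps z = (fine (mean_scaled_dist C nu z))%:E.
  by rewrite fineK// (mean_scaled_dist_fin_num C_ge0 Gy0).
have HV1' : (\int[mu]_z ((fine (mean_scaled_dist 1 mu z)) ^+ 2)%:E <= V1%:E)%E.
  rewrite ge0_integral_distribution//=.
  - by apply: le_trans HV1; under [leRHS]eq_integral do rewrite GXf.
  - apply/measurable_EFinP; apply: measurable_funX; exact: Gx_measurable Gx0.
  - by move=> z; rewrite lee_fin sqr_ge0.
have HV2' : (\int[nu]_z ((fine (mean_scaled_dist C nu z)) ^+ 2)%:E <= V2%:E)%E.
  rewrite ge0_integral_distribution//=.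
  - by apply: le_trans HV2; under [leRHS]eq_integral do rewrite Gef.
  - apply/measurable_EFinP; apply: measurable_funX; exact: Ge_measurable Gy0.
  - by move=> z; rewrite lee_fin sqr_ge0.
pose M := y * Kgeo N rho.
have K0 : 0 < Kgeo N rho.
  by rewrite (lt_le_trans ltr01)// -(@Kgeo0 _ rho) Kgeo_le.
have M0 : 0 < M by rewrite mulr_gt0.
have KyM m : (m <= N)%N -> Kgeo m rho * y <= M.
  by move=> mN; rewrite mulrC ler_pM2l// Kgeo_le.
(* the sign is absorbed into the function, which keeps its Lipschitz constants *)
pose g (u : nat -> TX) : R := (-1) ^+ b * f (fun i : 'I_N.+1 => u i).
have gL : last_lip N (Kgeo (N - N) rho) g.
  move=> u u'; rewrite /g -mulrBr normrMsign subnn Kgeo0 mul1r.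
  by apply: (le_trans (f_lip _ _)); rewrite big_ord_recr.
have [W WP] := clipped_sum_exists sepX eps_indep eps_ident X1_indep mF chain
  rho_ge0 C_gt0 F_contr F_lip Gx0 Gy0 M0 KyM HV1' HV2' (leqnn N) gL.
have gint : P.-integrable setT (EFin \o (fun w => g (trajectory X w))) by case: WP.
have fint : P.-integrable setT (EFin \o fX).
  have := integrableZl measurableT ((-1) ^+ b) gint.
  by apply: eq_integrable => // w _; rewrite /= -EFinM /g signrMK.
have gE : Rintegral P setT (fun w => g (trajectory X w)) = (-1) ^+ b * fine 'E_P[fX].
  by rewrite unlock -[fine _]/(Rintegral P setT fX) -RintegralZl.
have := clipped_sum_tail rho_ge0 C_gt0 Gx0 Gy0 M0 WP x_gt0 V1_gt0 (ltW V2_gt0).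
rewrite gE; congr (_ <= _)%E.
- by congr (P _); apply/funext => w /=; rewrite /S mulrBr.
- congr (_ + P _)%E.
  apply/seteqP; split => w; rewrite /= GXf lt_max lte_fin.
    move=> [->//|[i i2 yi]]; apply/orP; right; apply/lt_bigmaxe.
    by exists i; rewrite ?mem_index_iota// Gef lte_fin.
  move=> /orP[|/lt_bigmaxe[i]]; first by left.
  by rewrite mem_index_iota Gef lte_fin => iN yi; right; exists i.
Qed.
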